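(* Let $b\ge3$ be odd, $n$ an even positive integer, and $K$ the transition matrix of the balanced carries chain on $\{-\tfrac n2,\dots,\tfrac n2\}$. Then for $0\le j\le n$, \[ \lim_{r\to\infty}K^r(0,j-n/2)=\frac{\overline{A(n,j)}}{2^n n!}. \]
   Context: Balanced digits base $b$ ($b$ odd) are the integers $-\tfrac{b-1}{2},\dots,\tfrac{b-1}{2}$. When $n$ numbers in balanced digits are added column by column from right to left, if the carry into a column is $i$ and the column digits are $X_1,\dots,X_n$, the carry out is the unique integer $j$ with $jb-\tfrac{b-1}{2}\le i+X_1+\cdots+X_n\le jb+\tfrac{b-1}{2}$; the first carry is $0$. With all digits independent and uniform, the carries form a Markov chain (the balanced carries chain) with state space $\{-\tfrac n2,\dots,\tfrac n2\}$ for $n$ even, transition matrix $K$, and $K^r$ its $r$-step transition matrix. A signed permutation on $n$ symbols is a bijection $\sigma$ of $\{\pm1,\dots,\pm n\}$ with $\sigma(-k)=-\sigma(k)$, written $\sigma(1)\cdots\sigma(n)$; with the order $1<2<\cdots<n<-n<\cdots<-1$, $\sigma$ has a descent at $i\in\{1,\dots,n-1\}$ if $\sigma(i)>\sigma(i+1)$ and a descent at $n$ if $\sigma(n)<0$. $\overline{A(n,k)}$ is the number of signed permutations on $n$ symbols with exactly $k$ descents. *)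

(* Defs.v *)
From HB Require Import structures.
From mathcomp Require Import all_boot all_order all_fingroup all_algebra zify.
From mathcomp Require Import all_classical all_reals all_analysis.
Set Implicit Arguments.
Unset Strict Implicit.
Unset Printing Implicit Defensive.
Import Order.TTheory GRing.Theory Num.Theory.
Import numFieldNormedType.Exports.

Local Open Scope ring_scope.

(* d : 'I_b encodes the balanced digit d - (b - 1)/2; for b odd,
   b./2 = (b - 1)/2. *)
Definition digit_val (b : nat) (d : 'I_b) : int := d%:Z - (b./2)%:Z.

Definition is_carry (b n : nat) (i : int) (X : {ffun 'I_n -> 'I_b}) (j : int)
  : bool :=
  j * b%:Z - (b./2)%:Z <= i + \sum_(k < n) digit_val (X k)
    <= j * b%:Z + (b./2)%:Z.

(* s : 'I_n.+1 encodes the carry s - n/2; intended for n even. *)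
Definition carry_val (n : nat) (s : 'I_n.+1) : int := s%:Z - (n./2)%:Z.

Definition zero_carry (n : nat) : 'I_n.+1 := inord n./2.

(* The entry at (s, t) is the probability that the carry out is t, given that
   the carry in is s, for a column of n independent uniform balanced digits. *)
Definition balanced_carries (R : realType) (b n : nat) : 'M[R]_n.+1 :=
  \matrix_(s, t)
    (#|[set X : {ffun 'I_n -> 'I_b} | is_carry (carry_val s) X (carry_val t)]|%:R
       / (b ^ n)%:R).

(* (false, k) encodes the symbol k + 1 and (true, k) the symbol - (k + 1). *)
Definition symbol (n : nat) : finType := (bool * 'I_n)%type.

Definition pos_symbol (n : nat) (k : 'I_n) : symbol n := (false, k).

Definition opp_symbol (n : nat) (x : symbol n) : symbol n := (~~ x.1, x.2).

Definition is_neg_symbol (n : nat) (x : symbol n) : bool := x.1.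

(* The order 1 < 2 < ... < n < -n < ... < -2 < -1. *)
Definition symbol_lt (n : nat) (x y : symbol n) : bool :=
  match x, y with
  | (false, i), (false, j) => (i < j)%N
  | (false, _), (true, _) => true
  | (true, _), (false, _) => false
  | (true, i), (true, j) => (j < i)%N
  end.

Definition is_signed_perm (n : nat) (s : {perm symbol n}) : bool :=
  [forall x, s (opp_symbol x) == opp_symbol (s x)].

(* k : 'I_n stands for the position k + 1; insub k.+1 is None exactly at the
   last position. *)
Definition is_descent (n : nat) (s : {perm symbol n}) (k : 'I_n) : bool :=
  if insub k.+1 is Some k' then
    symbol_lt (s (pos_symbol k')) (s (pos_symbol k))
  else is_neg_symbol (s (pos_symbol k)).

Definition signed_descents (n : nat) (s : {perm symbol n}) : nat :=
  #|[set k | is_descent s k]|.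

Definition signed_eulerian (n k : nat) : nat :=
  #|[set s : {perm symbol n} | is_signed_perm s && (signed_descents s == k)]|.

Lemma carry_val_zero (n : nat) : carry_val (zero_carry n) = 0.
Proof.
rewrite /carry_val /zero_carry inordK ?subrr //.
by rewrite ltnS; lia.
Qed.

Lemma carry_existence (b n : nat) (s : 'I_n.+1) (X : {ffun 'I_n -> 'I_b}) :
  odd b -> ~~ odd n ->
  exists t : 'I_n.+1, is_carry (carry_val s) X (carry_val t).
Proof.
move=> bo ne; rewrite /is_carry.
set S := \sum_(k < n) _.
have Slo : - (n%:Z * (b./2)%:Z) <= S.
  have -> : - (n%:Z * (b./2)%:Z) = \sum_(k < n) - (b./2)%:Z.
    by rewrite sumrN sumr_const card_ord -mulr_natl natz.
  by apply: ler_sum => k _; rewrite /digit_val; lia.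
have Shi : S <= n%:Z * (b./2)%:Z.
  have -> : n%:Z * (b./2)%:Z = \sum_(k < n) (b./2)%:Z.
    by rewrite sumr_const card_ord -mulr_natl natz.
  apply: ler_sum => k _; rewrite /digit_val.
  by have := ltn_ord (X k); lia.
have := ltn_ord s; rewrite /carry_val.
move: (nat_of_ord s) => {s}s sn.
have [c bE] : exists c : nat, b = c.*2.+1.
  by exists b./2; lia.
have [m nE] : exists m : nat, n = m.*2.
  by exists n./2; lia.
have cE : b./2 = c by lia.
have mE : n./2 = m by lia.
rewrite cE mE in Slo Shi *.
set T := s%:Z - m%:Z + S.
have bn0 : b%:Z != 0 by lia.
pose q := ((T + c%:Z) %/ b%:Z)%Z; pose r := ((T + c%:Z) %% b%:Z)%Z.
have qE : T + c%:Z = q * b%:Z + r by exact: divz_eq.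
have r0 : 0 <= r by exact: modz_ge0.
have rb : r < b%:Z by apply: ltz_pmod; lia.
have qlo : - m%:Z <= q by rewrite /T in qE; nia.
have qhi : q <= m%:Z by rewrite /T in qE; nia.
have tn : (absz (q + m%:Z)%R < n.+1)%N by lia.
exists (Ordinal tn) => /=.
have -> : (absz (q + m%:Z))%:Z - m%:Z = q by lia.
by apply/andP; split; lia.
Qed.

Lemma carry_uniqueness (b n : nat) (i : int) (X : {ffun 'I_n -> 'I_b})
    (j j' : int) :
  odd b -> is_carry i X j -> is_carry i X j' -> j = j'.
Proof.
rewrite /is_carry; set T := i + _ => bo /andP[h1 h2] /andP[h3 h4].
have [c bE] : exists c : nat, b = c.*2.+1 by exists b./2; lia.
have cE : b./2 = c by lia.
rewrite cE in h1 h2 h3 h4; rewrite bE in h1 h2 h3 h4.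
nia.
Qed.

(* Main.v *)
Require Import Defs.
From HB Require Import structures.
From mathcomp Require Import all_boot all_order all_fingroup all_algebra.
From mathcomp Require Import zify ring.
From mathcomp Require Import all_classical all_reals all_analysis.
Set Implicit Arguments.
Unset Strict Implicit.
Unset Printing Implicit Defensive.
Import Order.TTheory GRing.Theory Num.Theory.
Import numFieldNormedType.Exports.
Local Open Scope ring_scope.

(* Put P_n(M) = C(M + n, n) for M >= 0 and P_n(M) = 0 for M < 0, and let phi_m
   be the function s |-> P_n(m - s) on the states 0, ..., n (state s encodes the
   carry s - n/2). Both sides of the limit satisfy the same unitriangular system
   in the values of phi_0, ..., phi_n.
   Carries: Euclidean division by b of n-tuples of naturals gives
   K phi_m = b^-n phi_(bm + (b-1)/2). The map m |-> bm + (b-1)/2 multiplies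
   2m + 1 by b, so (K^r phi_m)(n/2) tends to (2m + 1)^n / (2^n n!).
   Signed permutations: sum_k A(n,k) P_n(m - k) = (2m + 1)^n, because every word
   in {-m, ..., m}^n is sorted by exactly one signed permutation, and a signed
   permutation with k descents sorts P_n(m - k) of them. *)

(** * Counts of bounded tuples, and their division by [b] *)

(* The number of n-tuples of natural numbers with sum at most M. *)
Definition mbin (n : nat) (M : int) : nat :=
  if 0 <= M then 'C(absz M + n, n) else 0%N.

Lemma mbin_lt0 n M : M < 0 -> mbin n M = 0%N.
Proof. by rewrite /mbin leNgt => ->. Qed.

Lemma mbin0 n : mbin n 0 = 1%N.
Proof. by rewrite /mbin lexx binn. Qed.

(** Pascal's rule; the value 0 at negative arguments makes it hold for every integer [M]. *)
Lemma mbinS n M : mbin n.+1 M = (mbin n.+1 (M - 1) + mbin n M)%N.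
Proof.
rewrite /mbin; case: ifP => M0; last by rewrite ifF //; lia.
case: (eqVneq M 0) => [->|Mn0]; first by rewrite !binn.
have -> : 0 <= M - 1 by lia.
have -> : (absz M + n.+1 = (absz M + n).+1)%N by lia.
by rewrite binS; congr ('C(_, _) + _)%N; lia.
Qed.

Lemma sum_mbin n d u :
  (\sum_(x < u.+1) mbin n (x%:Z - d%:Z))%N = mbin n.+1 (u%:Z - d%:Z).
Proof.
elim: u => [|u IHu].
  rewrite big_ord1; case: d => [|d]; first by rewrite !mbin0.
  by rewrite !mbin_lt0 //; lia.
rewrite big_ord_recr IHu [RHS]mbinS /=; congr (mbin _ _ + _)%N; lia.
Qed.

Definition ffcons n (T : Type) (x : T) (f : {ffun 'I_n -> T}) :
  {ffun 'I_n.+1 -> T} := [ffun i => oapp f x (unlift ord0 i)].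

Lemma ffcons0 n T (x : T) (f : {ffun 'I_n -> T}) : ffcons x f ord0 = x.
Proof. by rewrite ffunE unlift_none. Qed.

Lemma ffconsS n T (x : T) (f : {ffun 'I_n -> T}) i :
  ffcons x f (lift ord0 i) = f i.
Proof. by rewrite ffunE liftK. Qed.

Lemma sum_ffcons n (T : finType) (F : {ffun 'I_n.+1 -> T} -> nat) :
  (\sum_f F f = \sum_x \sum_f F (ffcons x f))%N.
Proof.
rewrite pair_big /= (reindex (fun p => ffcons p.1 p.2)) //=.
exists (fun f => (f ord0, [ffun i => f (lift ord0 i)])) => [[x f] _|f _] /=.
  rewrite ffcons0; congr pair; apply/ffunP => i.
  by rewrite ffunE ffconsS.
apply/ffunP => i; case: (unliftP ord0 i) => [k|] ->.
  by rewrite ffconsS ffunE.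
by rewrite ffcons0.
Qed.

(** Division by [b] splits an [n]-tuple of naturals with sum at most [M] into remainders [X] and
    quotients whose sum is at most the floor shown. The proof instead checks that both sides obey
    the recurrence [mbinS] in [M]. *)
Lemma sum_mbin_digits b n (M : int) : (0 < b)%N ->
  (\sum_(X : {ffun 'I_n -> 'I_b})
     mbin n ((M - \sum_(k < n) (X k)%:Z) %/ b%:Z)%Z)%N = mbin n M.
Proof.
move=> b0; elim: n M => [|n IHn] M.
  have E (X : {ffun 'I_0 -> 'I_b}) :
      mbin 0 ((M - \sum_(k < 0) (X k)%:Z) %/ b%:Z)%Z = mbin 0 M.
    rewrite big_ord0 subr0 /mbin !bin0.
    by rewrite divz_ge0 //; lia.
  rewrite (eq_bigr _ (fun X _ => E X)) sum_nat_const card_ffun !card_ord.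
  exact: mul1n.
pose F (M : int) := (\sum_(X : {ffun 'I_n.+1 -> 'I_b})
     mbin n.+1 ((M - \sum_(k < n.+1) (X k)%:Z) %/ b%:Z)%Z)%N.
have FS (N : int) : F N = (F (N - 1)%R + mbin n N)%N.
  (* Telescoping in the first digit turns F N - F (N - 1) into the sum for n. *)
  pose G (y : int) := mbin n.+1 (y %/ b%:Z)%Z.
  have FE (N' : int) : F N' = (\sum_(X : {ffun 'I_n -> 'I_b}) \sum_(d < b)
       G (N' - \sum_(k < n) (X k)%:Z - d%:Z)%R)%N.
    rewrite /F sum_ffcons exchange_big /=; apply: eq_bigr => X _.
    apply: eq_bigr => d _; rewrite big_ord_recl ffcons0 /G.
    congr (mbin _ (_ %/ _)%Z); rewrite opprD addrA addrAC; congr (_ - _ - _).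
    by apply: eq_bigr => i _; rewrite ffconsS.
  rewrite !FE -(IHn N) -big_split; apply: eq_bigr => X _ /=.
  set y := N - _; rewrite (_ : N - 1 - _ = y - 1); last by rewrite /y addrAC.
  have GS : G y = (G (y - b%:Z)%R + mbin n (y %/ b%:Z)%Z)%N.
    rewrite /G mbinS; congr (mbin _ _ + _)%N.
    have -> : y - b%:Z = (-1) * b%:Z + y by lia.
    by rewrite divzMDl; lia.
  have T1 : (\sum_(d < b.+1) G (y - d%:Z)%R =
      (\sum_(d < b) G (y - d%:Z)%R) + G (y - b%:Z)%R)%N by rewrite big_ord_recr.
  have T2 : (\sum_(d < b.+1) G (y - d%:Z)%R =
      G y + \sum_(d < b) G (y - 1 - d%:Z)%R)%N.
    rewrite big_ord_recl subr0; congr addn; apply: eq_bigr => i _.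
    by congr G; rewrite /= /bump; lia.
  apply: (@addIn (G (y - b%:Z))); rewrite -T1 T2 GS addnC -[RHS]addnA.
  by congr addn; exact: addnC.
have Fneg (N : int) : N < 0 -> F N = 0%N.
  move=> N0; rewrite /F big1 // => X _; apply: mbin_lt0.
  rewrite ltNge divz_ge0 ?ltz_nat // -ltNge.
  by rewrite subr_lt0 (lt_le_trans N0) // sumr_ge0.
rewrite -/(F M); have [M0|M0] := ltP M 0; first by rewrite Fneg // mbin_lt0.
case: M M0 => // M _; elim: M => [|M IHM].
  by rewrite FS Fneg // !mbin0.
by rewrite FS mbinS (_ : M.+1%:Z - 1 = M%:Z) ?IHM //; lia.
Qed.

(** The polynomial formula for the binomial coefficient persists for negative [M] down to [- n],
    because one factor of the product is then zero. *)
Lemma mbin_fact (n : nat) (M : int) : - n%:Z <= M ->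
  (mbin n M)%:Z * n`!%:Z = \prod_(i < n) (M + i.+1%:Z).
Proof.
rewrite /mbin; case: ifP => M0 Mn.
  case: M M0 {Mn} => // M _; rewrite -PoszM bin_ffact /=.
  elim: n => [|n IHn]; first by rewrite big_ord0 ffactn0.
  by rewrite big_ord_recr /= -IHn -PoszD addnS ffactSS mulrC PoszM.
have ltMn : ((absz M).-1 < n)%N by lia.
rewrite mul0r (bigD1 (Ordinal ltMn)) //= (_ : M + _ = 0) ?mul0r //; lia.
Qed.

(** * Sorting by an injective key *)

Section Rank.
Variables (n : nat) (key : 'I_n -> nat).
Hypothesis key_inj : injective key.

Definition key_increasing (w : 'I_n -> 'I_n) :=
  forall p q : 'I_n, (p < q)%N -> (key (w p) < key (w q))%N.

Let below i : {set 'I_n} := [set j | (key j < key i)%N].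

(** The keys below that of [w p] are those of [w q] with [q < p], so the position of an index is its
    rank. *)
Lemma card_below w p : injective w -> key_increasing w ->
  #|below (w p)| = p.
Proof.
move=> w_inj w_incr.
have -> : below (w p) = w @: [set q : 'I_n | (q < p)%N].
  have [w' wK w'K] := injF_bij w_inj.
  apply/setP => j; rewrite -(w'K j) mem_imset // !inE.
  case: (ltngtP (w' j) p) => [/w_incr //|/w_incr|/val_inj ->].
    by move=> h; apply/negbTE; rewrite -leqNgt ltnW.
  by rewrite ltnn.
rewrite card_imset // cardsE -sum1_card.
rewrite (eq_bigl (fun q : 'I_n => (q < p)%N)) //.
rewrite (big_ord_narrow_cond (P := fun=> true) (ltnW (ltn_ord p))).
by rewrite sum1_card card_ord.
Qed.

Lemma key_increasing_uniq w1 w2 : injective w1 -> injective w2 ->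
  key_increasing w1 -> key_increasing w2 -> w1 =1 w2.
Proof.
move=> inj1 inj2 incr1 incr2 p.
have [w2' _ w2K] := injF_bij inj2.
rewrite -{1}(w2K (w1 p)); congr w2; apply: val_inj => /=.
by rewrite -(card_below _ inj2 incr2) w2K card_below.
Qed.

(** Ranks are distinct and less than [n], so the rank map is a bijection; its inverse is the
    enumeration sought. *)
Lemma key_increasing_exists : exists2 w, injective w & key_increasing w.
Proof.
have below_lt i : (#|below i| < n)%N.
  rewrite -[X in (_ < X)%N]card_ord -cardsT proper_card //.
  apply/properP; split; first exact: finset.subsetT.
  by exists i; rewrite ?inE ?ltnn.
have below_mono i j : (key i <= key j)%N -> (#|below i| <= #|below j|)%N.
  move=> ij; apply/subset_leq_card/fintype.subsetP => k; rewrite !inE => ki.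
  exact: leq_trans ki ij.
have below_mono_lt i j : (key i < key j)%N -> (#|below i| < #|below j|)%N.
  move=> ij; apply/proper_card/properP; split; last first.
    by exists i; rewrite !inE ?ltnn.
  apply/fintype.subsetP => k; rewrite !inE => ki.
  exact: leq_trans ki (ltnW ij).
pose rk i := Ordinal (below_lt i).
have rk_inj : injective rk.
  move=> i j /(congr1 val) /= e; apply: key_inj; apply/eqP.
  by case: ltngtP => // /below_mono_lt; rewrite e ltnn.
have [w rkK wK] := injF_bij rk_inj.
exists w; first exact: can_inj wK.
move=> p q pq; rewrite ltnNge; apply: contraTN pq => /below_mono h.
have E r : #|below (w r)| = r by rewrite -[RHS](congr1 val (wK r)).
by rewrite -leqNgt -(E p) -(E q).
Qed.

End Rank.

(** * Counting decreasing sequences with prescribed strict descents *)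

Definition ext n m (a : {ffun 'I_n -> 'I_m}) (p : nat) : nat :=
  if insub p is Some k then a k else 0%N.

Lemma ext_ord n m (a : {ffun 'I_n -> 'I_m}) (p : 'I_n) : ext a p = a p.
Proof. by rewrite /ext valK. Qed.

Lemma ext_oversize n m (a : {ffun 'I_n -> 'I_m}) p :
  (n <= p)%N -> ext a p = 0%N.
Proof. by move=> np; rewrite /ext insubN // -leqNgt. Qed.

Lemma ext_ffcons n m x (a : {ffun 'I_n -> 'I_m}) p :
  ext (ffcons x a) p.+1 = ext a p.
Proof.
have [pn|np] := ltnP p n; last by rewrite !ext_oversize.
rewrite (ext_ord a (Ordinal pn)) -(ffconsS x).
by rewrite -(ext_ord (ffcons x a) (lift ord0 _)).
Qed.

(* For D the indicator of a descent set: a decreases weakly, strictly at the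
   elements of D, with the convention that a vanishes past its last entry. *)
Definition dominates n m (D : 'I_n -> bool) (a : {ffun 'I_n -> 'I_m}) : bool :=
  [forall p : 'I_n, (D p + ext a p.+1 <= a p)%N].

Lemma dominates_ffcons n m D x (a : {ffun 'I_n -> 'I_m}) :
  dominates D (ffcons x a) =
  (D ord0 + ext a 0 <= x)%N && dominates (fun p => D (lift ord0 p)) a.
Proof.
apply/forallP/andP => [H|[H0 /forallP H] p].
  split; first by have := H ord0; rewrite ffcons0 ext_ffcons.
  by apply/forallP => p; have := H (lift ord0 p); rewrite ffconsS ext_ffcons.
case: (unliftP ord0 p) => [k|] ->; last by rewrite ffcons0 ext_ffcons.
by rewrite ffconsS ext_ffcons H.
Qed.

(** Subtracting from each entry the number of elements of [D] at or after it leaves a weakly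
    decreasing sequence bounded by [u] minus the size of [D]. The induction removes the first entry
    [x], which bounds the next one by [x - D ord0], and sums over [x]. *)
Lemma card_dominates_le n m (D : 'I_n -> bool) (u : nat) : (u <= m)%N ->
  (\sum_(a : {ffun 'I_n -> 'I_m.+1}) (dominates D a && (ext a 0 <= u)%N))%N =
  mbin n (u%:Z - (\sum_p D p)%N%:Z).
Proof.
elim: n D u => [|n IHn] D u um.
  rewrite [LHS](eq_bigr (fun=> 1%N)) => [|a _]; last first.
    by rewrite ext_oversize // (_ : dominates D a) //; apply/forallP; case.
  by rewrite big_ord0 subr0 sum1_card card_ffun !card_ord /mbin lez_nat bin0.
rewrite sum_ffcons [X in _ - X%:Z]big_ord_recl PoszD opprD addrA.
set d := (\sum_(i < n) D _)%N.
have E (x : 'I_m.+1) : (\sum_(a : {ffun 'I_n -> 'I_m.+1})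
     (dominates D (ffcons x a) && (ext (ffcons x a) 0 <= u)))%N =
     if (x <= u)%N then mbin n (x%:Z - (D ord0 + d)%N%:Z) else 0%N.
  have E0 a : ext (ffcons x a) 0 = x by rewrite (ext_ord _ ord0) ffcons0.
  case: ifP => xu; last by rewrite big1 // => a _; rewrite E0 xu andbF.
  have [Dx|xD] := leqP (D ord0) x; last first.
    rewrite big1 => [|a _]; last by rewrite dominates_ffcons; lia.
    by rewrite mbin_lt0 //; lia.
  (* The natural subtraction is exact, since [D ord0 <= x] here. *)
  rewrite (_ : x%:Z - _ = (x - D ord0)%N%:Z - d%:Z); last by lia.
  rewrite -IHn; last by have := ltn_ord x; lia.
  apply: eq_bigr => a _; rewrite dominates_ffcons E0 xu andbT andbC.
  by congr (_ && _ : nat); lia.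
rewrite (eq_bigr _ (fun x _ => E x)) -big_mkcond /=.
rewrite (_ : _ - _ - _ = u%:Z - (D ord0 + d)%N%:Z); last by lia.
rewrite -sum_mbin.
by rewrite (big_ord_widen m.+1 (fun x => mbin n (x%:Z - (D ord0 + d)%N%:Z))).
Qed.

Lemma card_dominates n m (D : 'I_n -> bool) :
  #|[set a : {ffun 'I_n -> 'I_m.+1} | dominates D a]| =
  mbin n (m%:Z - #|[set p | D p]|%:Z).
Proof.
have -> : #|[set p | D p]| = (\sum_p D p)%N.
  by rewrite -sum1dep_card big_mkcond; apply: eq_bigr => p _; case: (D p).
rewrite -(@card_dominates_le n m) // -sum1dep_card big_mkcond.
apply: eq_bigr => a _; rewrite (_ : (ext a 0 <= m)%N) ?andbT.
  by case: (dominates D a).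
by rewrite /ext; case: insubP => // k _ _; rewrite -ltnS.
Qed.

(** * Signed permutations as sorting orders of signed words *)

Definition symbol_code n (x : symbol n) : nat :=
  if x.1 then (n.*2.-1 - x.2)%N else x.2.

Lemma symbol_code_lt n (x : symbol n) : (symbol_code x < n.*2)%N.
Proof.
by case: x => [[] i]; rewrite /symbol_code /=; have := ltn_ord i; lia.
Qed.

Lemma symbol_code_inj n : injective (@symbol_code n).
Proof.
move=> [e i] [e' i']; rewrite /symbol_code /= => h.
have := ltn_ord i; have := ltn_ord i'.
case: e e' h => [] [] h lti' lti; try lia; congr pair; apply: val_inj => /=;
  lia.
Qed.

Lemma symbol_ltE n (x y : symbol n) :
  symbol_lt x y = (symbol_code x < symbol_code y)%N.
Proof.
case: x y => [e i] [e' i']; rewrite /symbol_code /=.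
have := ltn_ord i; have := ltn_ord i'.
by case: e; case: e'; lia.
Qed.

Section Signed.
Variables n m : nat.
Implicit Types (s : {perm symbol n}) (a : {ffun 'I_n -> 'I_m.+1}).
Implicit Types (f : {ffun 'I_n -> bool * 'I_m.+1}).

(* A nonzero value v of {-m, ..., m} is encoded by (v < 0, |v|), and 0 only by
   (false, 0). *)
Definition sign_mag : pred (bool * 'I_m.+1) :=
  [pred x : bool * 'I_m.+1 | x.1 ==> (0 < x.2)%N].

Lemma card_sign_mag : #|sign_mag| = m.*2.+1.
Proof.
have -> : #|sign_mag| = (\sum_(e : bool) \sum_(x < m.+1 | e ==> (0 < x)%N) 1)%N.
  by rewrite pair_big_dep -sum1_card; apply: eq_bigl.
rewrite big_bool /= big_mkcond big_ord_recl /=.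
by rewrite !sum1_card !card_ord; lia.
Qed.

Definition place s (p : 'I_n) : 'I_n := (s (pos_symbol p)).2.

Lemma signed_opp s x : is_signed_perm s -> s (opp_symbol x) = opp_symbol (s x).
Proof. by move/forallP/(_ x)/eqP. Qed.

(** Opposite images of [p] and [q] would give [s p = s (- q)], hence [p = - q] for two positive
    symbols. *)
Lemma place_inj s : is_signed_perm s -> injective (place s).
Proof.
move=> sgn p q; rewrite /place => h.
have [/perm_inj [] //|/eqP h'] := eqVneq (s (pos_symbol p)) (s (pos_symbol q)).
suff : s (pos_symbol p) = s (opp_symbol (pos_symbol q)) by move/perm_inj.
rewrite signed_opp // /opp_symbol; move: h h'.
case: (s _) (s _) => [e k] [e' k'] /= -> h.
by congr pair; case: e e' h => [] [].
Qed.

(* The letter at |s(p)| has the sign of s(p) and absolute value a(p). *)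
Definition word_of s a : {ffun 'I_n -> bool * 'I_m.+1} :=
  [ffun k => let x := (s^-1)%g (pos_symbol k) in (x.1, a x.2)].

Lemma word_of_place s a p : is_signed_perm s ->
  word_of s a (place s p) = ((s (pos_symbol p)).1, a p).
Proof.
move=> sgn; rewrite ffunE /place /=.
case E : (s (pos_symbol p)) => [e k] /=.
suff -> : (s^-1)%g (pos_symbol k) = (e, p) by [].
apply: (@perm_inj _ s); rewrite permKV; case: e E => E.
  by rewrite -[(true, p)]/(opp_symbol (pos_symbol p)) signed_opp // E.
by rewrite -[(false, p)]/(pos_symbol p) E.
Qed.

(* Sorting by this key is sorting by decreasing absolute value, ties being
   broken by the order on the symbols +-k, with the sign of the k-th letter. *)
Definition word_key f (k : 'I_n) : nat :=
  ((m - (f k).2) * n.*2 + symbol_code ((f k).1, k))%N.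

Lemma lex_lt N c c' x y : (c < N)%N -> (c' < N)%N ->
  (x * N + c < y * N + c')%N = (x < y)%N || ((x == y) && (c < c')%N).
Proof. by move=> cN c'N; case: (ltngtP x y) => [xy|yx|->]; nia. Qed.

Lemma word_key_lt f i j : (word_key f i < word_key f j)%N =
  ((f j).2 < (f i).2)%N ||
  (((f j).2 == (f i).2) && symbol_lt ((f i).1, i) ((f j).1, j)).
Proof.
rewrite /word_key lex_lt ?symbol_code_lt // symbol_ltE.
move: (f i).2 (f j).2 => [y yP] [x xP] /=.
rewrite (_ : (Ordinal xP == Ordinal yP) = (x == y)) //.
move: (symbol_code _ < symbol_code _)%N => c.
case: (ltngtP x y) => h; case: c; lia.
Qed.

Lemma word_key_inj f : injective (word_key f).
Proof.
move=> i j; rewrite /word_key => h.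
have := congr1 (modn^~ n.*2) h.
by rewrite !modnMDl !modn_small ?symbol_code_lt // => /symbol_code_inj [].
Qed.

(** Before the last position, the condition at [p] says that the key increases from [place s p] to
    the next place: equal absolute values are allowed exactly when [s] has no descent. At the last
    position it forbids a negative zero. *)
Lemma dominates_key s a : is_signed_perm s ->
  dominates (is_descent s) a <->
  word_of s a \in ffun_on sign_mag /\
  key_increasing (word_key (word_of s a)) (place s).
Proof.
move=> sgn; set f := word_of s a.
have fE p : f (place s p) = ((s (pos_symbol p)).1, a p) by exact: word_of_place.
have keyE p q : (word_key f (place s p) < word_key f (place s q))%N =
   (a q < a p)%N || ((a q == a p) &&
                          symbol_lt (s (pos_symbol p)) (s (pos_symbol q))).
  rewrite word_key_lt !fE /= /place.
  by case: (s (pos_symbol p)) (s (pos_symbol q)) => [e k] [e' k'].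
have step (p q : 'I_n) : q = p.+1 :> nat ->
    (is_descent s p + ext a p.+1 <= a p)%N =
    (word_key f (place s p) < word_key f (place s q))%N.
  move=> qE; rewrite keyE -qE ext_ord /is_descent -qE valK !symbol_ltE.
  rewrite -val_eqE /=.
  have : symbol_code (s (pos_symbol p)) != symbol_code (s (pos_symbol q)).
    apply/eqP => /symbol_code_inj /perm_inj [] /(congr1 val) /= h; lia.
  by lia.
have last_step (p : 'I_n) : p.+1 = n ->
    (is_descent s p + ext a p.+1 <= a p)%N = (f (place s p) \in sign_mag).
  move=> pE; rewrite fE ext_oversize ?pE // addn0 /is_descent.
  rewrite insubN -?leqNgt ?pE //.
  by rewrite inE /is_neg_symbol /=; case: (s _).1.
split=> [/forallP dom|[/ffun_onP fA incr]].
  have incr : key_increasing (word_key f) (place s).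
    move=> p q pq.
    have [d] := ubnP (q - p)%N; elim: d q pq => // d IHd q pq dq.
    have q1n : (q.-1 < n)%N by have := ltn_ord q; lia.
    have qs : q = (Ordinal q1n).+1 :> nat by rewrite /=; lia.
    have h : (word_key f (place s (Ordinal q1n)) < word_key f (place s q))%N.
      by rewrite -step.
    have [->|] := eqVneq p (Ordinal q1n); first exact: h.
    rewrite -val_eqE /= => pn; apply: ltn_trans h; apply: IHd => /=; lia.
  split => //; apply/ffun_onP => k.
  have [w wK wV] := injF_bij (place_inj sgn).
  rewrite -(wV k); move: (w k) => {k wK wV w} p.
  (* Backward induction from the last position: after a negative zero, the next letter would again
     be a zero with a larger, hence negative, symbol. *)
  have [d] := ubnP (n - p)%N; elim: d p => // d IHd p dp.
  have [pn|np] := ltnP p.+1 n; last first.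
    by rewrite -last_step //; have := ltn_ord p; lia.
  have := IHd (Ordinal pn) ltac:(move: dp => /=; lia).
  have := incr p (Ordinal pn) (leqnn _).
  rewrite keyE !fE !inE /= symbol_ltE /symbol_code.
  move: (s (pos_symbol p)) (s (pos_symbol (Ordinal pn))) => [e k] [e' k'] /=.
  rewrite -val_eqE /=; have := ltn_ord k; have := ltn_ord k'.
  case: e e' => [] []; lia.
apply/forallP => p; have [pn|np] := ltnP p.+1 n; last first.
  by rewrite last_step //; have := ltn_ord p; lia.
by rewrite (step p (Ordinal pn)) //; apply: incr => /=.
Qed.

Let compatible : {set {perm symbol n} * {ffun 'I_n -> 'I_m.+1}} :=
  [set sa | is_signed_perm sa.1 && dominates (is_descent sa.1) sa.2].

(** Uniqueness of the sorting order recovers [place s] from the word; the letters then give the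
    signs of [s] and the entries of [a]. *)
Lemma word_of_inj : {in compatible &, injective (fun sa => word_of sa.1 sa.2)}.
Proof.
move=> [s a] [s' a']; rewrite !inE /= => /andP[sgn dom] /andP[sgn' dom'] ff.
have [_ incr] := (dominates_key a sgn).1 dom.
have [_ incr'] := (dominates_key a' sgn').1 dom'.
rewrite -ff in incr'.
have pE : place s =1 place s'.
  by apply: (key_increasing_uniq (place_inj sgn) (place_inj sgn') incr incr').
have E p : ((s (pos_symbol p)).1, a p) = ((s' (pos_symbol p)).1, a' p).
  by rewrite -!word_of_place // ff pE.
have sE p : s (pos_symbol p) = s' (pos_symbol p).
  have := E p; have := pE p; rewrite /place.
  by case: (s _) (s' _) => [e k] [e' k'] /= -> [-> _].
congr pair; last by apply/ffunP => p; case: (E p).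
apply/permP => -[[] p]; last exact: sE.
by rewrite -[(true, p)]/(opp_symbol (pos_symbol p)) !signed_opp // sE.
Qed.

(** The key order of the letters gives the absolute values of [s], their signs the signs of [s], and
    their sorted absolute values [a]. *)
Lemma word_of_surj f : f \in ffun_on sign_mag ->
  exists2 sa, sa \in compatible & f = word_of sa.1 sa.2.
Proof.
move=> fA; have [w w_inj incr] := key_increasing_exists (@word_key_inj f).
pose g (x : symbol n) : symbol n := (x.1 (+) (f (w x.2)).1, w x.2).
have g_inj : injective g.
  by move=> [e p] [e' q] [] /[swap] /w_inj -> /addIb ->.
pose s := perm g_inj; pose a := [ffun p => (f (w p)).2].
have sgn : is_signed_perm s.
  by apply/forallP => -[e p]; rewrite !permE /g /opp_symbol /= addNb.
have pE : place s =1 w by move=> p; rewrite /place permE.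
have fE : f = word_of s a.
  have [w' _ wV] := injF_bij w_inj.
  apply/ffunP => k; rewrite -(wV k) -[in RHS]pE word_of_place // permE /= ffunE.
  by case: (f _).
exists (s, a) => //; rewrite inE /= sgn /=.
apply/(dominates_key a sgn); rewrite -fE; split => // p q pq.
by rewrite !pE; apply: incr.
Qed.

(** Signed analogue of Worpitzky's identity: [compatible] is counted once through its bijection with
    words and once by descent number. *)
Lemma worpitzky_signed :
  (\sum_(k < n.+1) signed_eulerian n k * mbin n (m%:Z - k%:Z))%N =
  (m.*2.+1 ^ n)%N.
Proof.
rewrite -card_sign_mag -[in RHS](card_ord n) -card_ffun_on.
have imE : [set word_of sa.1 sa.2 | sa in compatible] =
    [set f | f \in ffun_on sign_mag].
  apply/setP => f; rewrite [RHS]inE.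
  apply/imsetP/idP => [[[s a]]|/word_of_surj [sa ? ?]]; last by exists sa.
  by rewrite inE /= => /andP[sgn dom] ->; case: ((dominates_key a sgn).1 dom).
rewrite -[RHS]cardsE -imE (card_in_imset word_of_inj).
rewrite -sum1dep_card.
rewrite -(pair_big_dep (@is_signed_perm n)
  (fun s a => dominates (is_descent s) a) (fun _ _ => 1%N)) /=.
rewrite (eq_bigr (fun s => mbin n (m%:Z - (signed_descents s)%:Z))); last first.
  by move=> s _; rewrite sum1dep_card card_dominates.
have des_lt s : (signed_descents s < n.+1)%N.
  by rewrite ltnS -[X in (_ <= X)%N](card_ord n) max_card.
rewrite (partition_big (fun s => Ordinal (des_lt s)) xpredT) //=.
apply: eq_bigr => k _; rewrite /signed_eulerian -sum1dep_card big_distrl /=.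
apply: eq_big => [s|s /andP[_ /eqP <-]]; first by rewrite -val_eqE.
by rewrite mul1n.
Qed.

End Signed.

(** * Action of the carries chain on the functions [mbin] *)

(** With [n = 2c] and [b = 2h + 1], the shifts of carries and digits cancel because [c b = c + n h];
    this leaves [t b - h <= s + S <= t b + h], where [S] sums the unshifted digits. *)
Lemma is_carry_divE b n (s t : 'I_n.+1) (X : {ffun 'I_n -> 'I_b}) (m : int) :
  odd b -> ~~ odd n -> is_carry (carry_val s) X (carry_val t) ->
  m - t%:Z =
  ((m * b%:Z + (b./2)%:Z - s%:Z - \sum_(k < n) (X k)%:Z) %/ b%:Z)%Z.
Proof.
move=> bo ne; rewrite /is_carry /carry_val /digit_val sumrB sumr_const card_ord.
set S := \sum_(k < n) _; rewrite -mulr_natl natz => /andP[lo hi].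
have [h bE] : exists h : nat, b = h.*2.+1 by exists b./2; lia.
have [c nE] : exists c : nat, n = c.*2 by exists n./2; lia.
have hE : b./2 = h by lia.
have cE : n./2 = c by lia.
move: lo hi; rewrite hE cE => lo hi.
set y := _ - S; pose q := m - t%:Z.
have y_lo : q * b%:Z <= y by rewrite /q /y; nia.
have y_hi : y < q * b%:Z + b%:Z by rewrite /q /y; nia.
have b0 : b%:Z != 0 by lia.
have -> : y = q * b%:Z + (y - q * b%:Z) by rewrite addrC subrK.
rewrite divzMDl // divz_small ?addr0 //.
by apply/andP; split; lia.
Qed.

(** Each column [X] has exactly one carry out, so the sum over [t] becomes a sum over [X], to which
    [sum_mbin_digits] applies. *)
Lemma sum_carry_mbin b n (s : 'I_n.+1) (m : nat) : odd b -> ~~ odd n ->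
  (\sum_(t < n.+1) #|[set X : {ffun 'I_n -> 'I_b} |
      is_carry (carry_val s) X (carry_val t)]| * mbin n (m%:Z - t%:Z))%N =
  mbin n ((m * b + b./2)%N%:Z - s%:Z).
Proof.
move=> bo ne; have b0 : (0 < b)%N by case: b bo.
rewrite -(sum_mbin_digits _ _ b0).
under eq_bigr => t _ do rewrite -sum1dep_card big_distrl big_mkcond /=.
rewrite exchange_big /=; apply: eq_bigr => X _.
have [t tP] := carry_existence s X bo ne.
rewrite (bigD1 t) //= tP mul1n big1 ?addn0 => [|t' t't].
  by rewrite (is_carry_divE _ bo ne tP) PoszD PoszM.
case: ifP => // t'P; case/eqP: t't.
have := carry_uniqueness bo t'P tP; rewrite /carry_val => h.
by apply: val_inj => /=; lia.
Qed.

(** * Passage to the limit *)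

Local Open Scope classical_set_scope.
Local Open Scope ring_scope.

Section Limit.
Variables (R : realType) (b n : nat).
Hypotheses (b_ge3 : (3 <= b)%N) (b_odd : odd b) (n_even : ~~ odd n).

Let K := balanced_carries R b n.

Definition mbin_col (m : nat) : 'cV[R]_n.+1 :=
  \col_t (mbin n (m%:Z - t%:Z))%:R.

Lemma carries_mbin_col m :
  K *m mbin_col m = ((b ^ n)%:R)^-1 *: mbin_col (m * b + b./2).
Proof.
apply/matrixP => s z; rewrite !mxE -(sum_carry_mbin s m b_odd n_even).
rewrite natr_sum big_distrr; apply: eq_bigr => t _ /=.
by rewrite !mxE natrM mulrA; congr (_ * _); rewrite mulrC.
Qed.

Definition carry_iter r m := iter r (fun m => m * b + b./2)%N m.

Lemma carry_iterE r m : (carry_iter r m).*2.+1 = (b ^ r * m.*2.+1)%N.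
Proof.
elim: r => [|r IHr]; first by rewrite expn0 mul1n.
rewrite expnS -mulnA -IHr /carry_iter iterS -/(carry_iter r m).
have [h bE] : exists h : nat, b = h.*2.+1 by exists b./2; lia.
rewrite bE (_ : (h.*2.+1)./2 = h); [nia | lia].
Qed.

Lemma carries_exp_mbin_col r m :
  K ^+ r *m mbin_col m = (((b ^ n)%:R)^-1 ^+ r) *: mbin_col (carry_iter r m).
Proof.
elim: r => [|r IHr]; first by rewrite !expr0 mul1mx scale1r.
rewrite [K ^+ _]exprS -mulmxA IHr -scalemxAr carries_mbin_col scalerA.
by rewrite -exprSr /carry_iter iterS.
Qed.

(** Each of the [n] factors given by [mbin_fact] absorbs one [b^-r] and then tends to
    [(2m + 1) / 2]. *)
Lemma cvg_mbin m : (fun r => ((b ^ n)%:R)^-1 ^+ r *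
    (mbin n ((carry_iter r m)%:Z - (n./2)%:Z))%:R : R) @ \oo -->
  ((m.*2.+1 ^ n)%:R / (2 ^ n * n`!)%:R : R).
Proof.
have b0 : b%:R != 0 :> R by rewrite pnatr_eq0; lia.
(* The part of factor [i] independent of [r], after substituting
   [carry_iter r m = (b^r (2m + 1) - 1) / 2]. *)
pose c (i : nat) : R := i.+1%:R - (n./2)%:R - 2^-1.
have -> : (fun r => ((b ^ n)%:R)^-1 ^+ r *
      (mbin n ((carry_iter r m)%:Z - (n./2)%:Z))%:R : R) =
    (fun r => n`!%:R^-1 *
      \prod_(i < n) (m.*2.+1%:R / 2 + c i * b%:R^-1 ^+ r)).
  apply/funext => r; have := @mbin_fact n ((carry_iter r m)%:Z - (n./2)%:Z).
  move=> /(_ ltac:(lia)) /(congr1 (fun z : int => z%:~R : R)).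
  rewrite rmorphM /= rmorph_prod /= => h.
  have fact0 : n`!%:R != 0 :> R by rewrite pnatr_eq0 -lt0n fact_gt0.
  apply: (mulfI fact0); rewrite [RHS]mulVKf // mulrCA [n`!%:R * _]mulrC.
  rewrite -!pmulrn in h; rewrite h.
  rewrite natrX exprVn exprAC -exprVn -[n in _ ^- _ ^+ n]card_ord.
  rewrite -prodr_const -big_split.
  apply: eq_bigr => i _ /=.
  have := congr1 (fun k => k%:R : R) (carry_iterE r m).
  rewrite -addn1 natrD -muln2 natrM natrM natrX => E.
  rewrite !rmorphD rmorphN /= -!pmulrn exprVn /c.
  have br0 : b%:R ^+ r != 0 :> R by rewrite expf_neq0.
  have -> : (carry_iter r m)%:R = (b%:R ^+ r * m.*2.+1%:R - 1) / 2 :> R.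
    by rewrite -E; field.
  by field.
(* The limit is written as the same product with [b^-r] replaced by 0, so that convergence is
   checked factor by factor. *)
have -> : (m.*2.+1 ^ n)%:R / (2 ^ n * n`!)%:R =
    n`!%:R^-1 * \prod_(i < n) (m.*2.+1%:R / 2 + c i * 0) :> R.
  under eq_bigr => i _ do rewrite mulr0 addr0.
  by rewrite prodr_const card_ord natrM invfM mulrA mulrC expr_div_n !natrX.
apply: cvgM; first exact: cvg_cst.
have bV : (fun r => b%:R^-1 ^+ r : R) @ \oo --> (0 : R).
  apply: cvg_expr; rewrite ger0_norm ?invr_ge0 //.
  by rewrite invf_lt1 ?ltr1n ?ltr0n; lia.
apply: cvg_big => [|i _].
  by apply: mul_continuous.
apply: cvgD; first exact: cvg_cst.
by apply: cvgM; [exact: cvg_cst|].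
Qed.

Lemma cvg_carries (j : 'I_n.+1) :
  (fun r => (K ^+ r) (zero_carry n) j) @ \oo -->
  ((signed_eulerian n j)%:R / (2 ^ n * n`!)%:R : R).
Proof.
pose x r (i : 'I_n.+1) := (K ^+ r) (zero_carry n) i.
pose y (i : 'I_n.+1) : R := (signed_eulerian n i)%:R / (2 ^ n * n`!)%:R.
pose P (k i : 'I_n.+1) : R := (mbin n (k%:Z - i%:Z))%:R.
have xP (k : 'I_n.+1) :
    (fun r => \sum_i x r i * P k i) @ \oo --> \sum_i y i * P k i.
  have -> : \sum_i y i * P k i = (k.*2.+1 ^ n)%:R / (2 ^ n * n`!)%:R.
    rewrite -worpitzky_signed natr_sum big_distrl; apply: eq_bigr => i _ /=.
    by rewrite natrM mulrAC.
  have -> : (fun r => \sum_i x r i * P k i) = (fun r => ((b ^ n)%:R)^-1 ^+ r *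
    (mbin n ((carry_iter r k)%:Z - (n./2)%:Z))%:R : R).
    apply/funext => r.
    have := congr1 (fun M : 'cV[R]_n.+1 => M (zero_carry n) 0)
      (carries_exp_mbin_col r k).
    rewrite !mxE inordK => [<-|]; last by lia.
    by apply: eq_bigr => i _; rewrite mxE.
  exact: cvg_mbin.
(* mbin n (k - i) is 1 for i = k and 0 for i > k, so x r k is determined by the
   sums above and the x r i with i < k. *)
suff H (d : nat) (i : 'I_n.+1) : (i < d)%N -> (fun r => x r i) @ \oo --> y i.
  exact: (H j.+1).
elim: d i => // d IHd k kd.
have split (z : 'I_n.+1 -> R) :
    z k = \sum_i z i * P k i - \sum_(i < n.+1 | (i < k)%N) z i * P k i.
  rewrite (bigID (fun i : 'I_n.+1 => (i < k)%N)) /= addrAC subrr add0r.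
  rewrite (bigD1 k) ?ltnn //= big1 => [|i /andP[ik ne]].
    by rewrite /P subrr mbin0 mulr1 addr0.
  have ki : (k < i)%N by rewrite ltn_neqAle eq_sym leqNgt ik andbT.
  by rewrite /P mbin_lt0 ?mulr0 //; lia.
rewrite (split y) (_ : (fun r => x r k) = (fun r => \sum_i x r i * P k i -
    \sum_(i < n.+1 | (i < k)%N) x r i * P k i)); last first.
  by apply/funext => r; exact: split.
apply: cvgB; first exact: xP.
apply: cvg_big => [|i ik]; first exact: add_continuous.
apply: cvgM; last exact: cvg_cst.
by apply: IHd; apply: leq_trans ik _; rewrite -ltnS.
Qed.

End Limit.

Theorem theorem3p3 (R : realType) (b n : nat)
    (b_ge3 : (3 <= b)%N) (b_odd : odd b)
    (n_gt0 : (0 < n)%N) (n_even : ~~ odd n) (j : 'I_n.+1) :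
  (fun r : nat => (balanced_carries R b n ^+ r) (zero_carry n) j) @ \oo
    --> ((signed_eulerian n j)%:R / (2 ^ n * n`!)%:R : R).
Proof. exact: cvg_carries. Qed.
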